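(* For every real $r\in(0,1)$ and every 1-random set $X\subseteq\omega$, the join $r\oplus X$ computes a set of intrinsic density $r$.
   Context: A real $r\in(0,1)$ is identified with the set $\{n : \text{the } n\text{-th bit of the binary expansion of } r \text{ is } 1\}$; $Y\oplus X=\{2n:n\in Y\}\cup\{2n+1:n\in X\}$. 1-random means Martin-Löf random with respect to the uniform (fair-coin) measure. For $A\subseteq\omega$, $\rho_n(A)=|A\cap\{0,\dots,n-1\}|/n$ and $\rho(A)=\lim_n\rho_n(A)$ when it exists. $A$ has intrinsic density $\alpha$ if $\rho(\pi(A))=\alpha$ for every computable permutation $\pi$ of $\omega$. *)

(* Defs.v *)
From HB Require Import structures.
From mathcomp Require Import all_boot all_order all_algebra.
From mathcomp Require Import all_classical all_reals all_analysis.

Set Implicit Arguments.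
Unset Strict Implicit.
Unset Printing Implicit Defensive.

Import Order.TTheory GRing.Theory Num.Theory.
Import numFieldNormedType.Exports.

Local Open Scope classical_set_scope.

(* Total functions recursive in the oracle B, generated by composition,
   primitive recursion and minimization restricted to regular functions (those
   for which the search always succeeds).  By Kleene's normal form theorem these
   are exactly the total functions computable by an oracle machine. *)
Inductive recursive_in (B : set nat) :
    forall k : nat, (k.-tuple nat -> nat) -> Prop :=
| rec_zero : recursive_in B (fun _ : 0.-tuple nat => 0)
| rec_succ : recursive_in B (fun t : 1.-tuple nat => (thead t).+1)
| rec_oracle :
    recursive_in B (fun t : 1.-tuple nat => nat_of_bool (thead t \in B))
| rec_proj (k : nat) (i : 'I_k) :
    recursive_in B (fun t : k.-tuple nat => tnth t i)
| rec_comp (k m : nat) (f : m.-tuple nat -> nat)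
    (g : 'I_m -> k.-tuple nat -> nat) :
    recursive_in B f -> (forall i, recursive_in B (g i)) ->
    recursive_in B (fun t => f [tuple g i t | i < m])
| rec_prim (k : nat) (f : k.-tuple nat -> nat) (g : k.+2.-tuple nat -> nat)
    (h : k.+1.-tuple nat -> nat) :
    recursive_in B f -> recursive_in B g ->
    (forall t : k.-tuple nat, h [tuple of 0 :: t] = f t) ->
    (forall n (t : k.-tuple nat),
       h [tuple of n.+1 :: t] = g [tuple of n :: h [tuple of n :: t] :: t]) ->
    recursive_in B h
| rec_min (k : nat) (f : k.+1.-tuple nat -> nat) (h : k.-tuple nat -> nat) :
    recursive_in B f ->
    (forall t : k.-tuple nat, f [tuple of h t :: t] = 0) ->
    (forall (t : k.-tuple nat) y, y < h t -> f [tuple of y :: t] <> 0) ->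
    recursive_in B h.

Definition recursive (k : nat) (f : k.-tuple nat -> nat) : Prop :=
  recursive_in set0 f.

Definition computable (f : nat -> nat) : Prop :=
  recursive (fun t : 1.-tuple nat => f (thead t)).

Definition computes (B A : set nat) : Prop :=
  recursive_in B (fun t : 1.-tuple nat => nat_of_bool (thead t \in A)).

Definition ce (k : nat) (P : set (k.-tuple nat)) : Prop :=
  exists2 f : k.+1.-tuple nat -> nat,
    recursive f & forall t, P t <-> exists s, f [tuple of s :: t] = 0.

Definition join (Y X : set nat) : set nat :=
  [set n.*2 | n in Y] `|` [set n.*2.+1 | n in X].

(* Bit 0 is the first bit after the binary point; a dyadic rational gets its
   terminating expansion. *)
Definition bits (R : realType) (x : R) : set nat :=
  [set n | odd `|Num.floor (x * 2 ^+ n.+1)%R|%N].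

(* A bijection between binary strings and nat (bijective base 2, least
   significant digit first). *)
Fixpoint string_code (s : seq bool) : nat :=
  if s is b :: s' then (string_code s').*2 + b.+1 else 0.

Definition cylinder (s : seq bool) : set (set nat) :=
  [set X | forall i, i < size s -> (i \in X) = nth false s i].

(* The fair-coin measure, as the image of Lebesgue measure on [0, 1[ under
   x |-> bits x. *)
Definition fair_coin (R : realType) (U : set (set nat)) : \bar R :=
  lebesgue_measure (`[0%R, 1%R[ `&` @bits R @^-1` U).

Definition open_class (W : set (seq bool)) : set (set nat) :=
  \bigcup_(s in W) cylinder s.

Definition ML_test (R : realType) (W : nat -> set (seq bool)) : Prop :=
  ce [set t : 2.-tuple nat |
       exists n s, W n s /\ t = [tuple n; string_code s]] /\
  forall n, (fair_coin R (open_class (W n)) <= (2 ^- n)%R%:E)%E.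

Definition ML_random (R : realType) (X : set nat) : Prop :=
  forall W, ML_test R W -> ~ (\bigcap_n open_class (W n)) X.

Definition rho_n (R : realType) (A : set nat) (n : nat) : R :=
  ((count (fun i => i \in A) (iota 0 n))%:R / n%:R)%R.

Definition has_density (R : realType) (A : set nat) (a : R) : Prop :=
  rho_n R A n @[n --> \oo] --> a.

Definition has_intrinsic_density (R : realType) (A : set nat) (a : R) : Prop :=
  forall pi : nat -> nat, computable pi -> bijective pi ->
    has_density (pi @` A) a.

(* Main.v *)
Require Import Defs.
From HB Require Import structures.
From mathcomp Require Import all_boot all_order all_algebra.
From mathcomp Require Import all_classical all_reals all_analysis.
From mathcomp Require Import zify lra.

(* Arrange the bits of X in columns through an injective pairing [position].
   Put n in A when the first column i <= n containing n belongs to the bits of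
   r. The set D_i of those n whose first column is i has "probability"
   2^-(i+1). Given a computable permutation with inverse sigma, the events
   "sigma m is in D_i" are independent, so by Chernoff's bound the first N of
   them contain at most (2^-(i+1) - d) N successes with probability at most c^N
   for some c < 1; the tails of the union over N form a Martin-Loef test, which
   X passes. Hence every image of D_i has lower density at least 2^-(i+1), and
   this for all i determines the density of A: up to finitely many elements A
   contains any finite union of the D_i with i among the bits of r, and it is
   disjoint from the other D_i.
   Only one D_i is tested at a time, so no test mentions r, and X need not be
   random relative to r. *)

Set Implicit Arguments.
Unset Strict Implicit.
Unset Printing Implicit Defensive.

Import Order.TTheory GRing.Theory Num.Theory.
Import numFieldNormedType.Exports.

Local Open Scope classical_set_scope.

(** * Closure properties of relatively recursive functions *)

(* Arguments are read off an untyped list, so that [nth 0 s i] is variable [i]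
   and binding a variable is consing onto [s]. *)
Definition rec_fun (B : set nat) (k : nat) (F : seq nat -> nat) : Prop :=
  recursive_in B (fun t : k.-tuple nat => F t).

Section RecFun.
Variable B : set nat.
Local Notation rec := (rec_fun B).

Lemma rec_fun_ext k F G :
  rec k F -> (forall s, size s = k -> F s = G s) -> rec k G.
Proof.
rewrite /rec_fun => rF eFG.
suff -> : (fun t : k.-tuple nat => G t) = (fun t => F t) by [].
by apply/funext => t; rewrite eFG // size_tuple.
Qed.

Lemma rec_fun_nth k i : i < k -> rec k (nth 0 ^~ i).
Proof.
move=> lik; rewrite /rec_fun.
suff -> : (fun t : k.-tuple nat => nth 0 t i) = (fun t => tnth t (Ordinal lik)).
  exact: rec_proj.
by apply/funext => t; rewrite (tnth_nth 0).
Qed.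

Lemma rec_fun_comp m k F (G : nat -> seq nat -> nat) :
  rec m F -> (forall i, i < m -> rec k (G i)) ->
  rec k (fun s => F (mkseq (G^~ s) m)).
Proof.
move=> rF rG; rewrite /rec_fun.
have := rec_comp rF (fun i : 'I_m => rG i (ltn_ord i)).
congr recursive_in; apply/funext => t; congr F.
apply: (@eq_from_nth _ 0); rewrite ?size_tuple ?size_mkseq // => i lim.
by rewrite nth_mkseq // -(tnth_nth 0 _ (Ordinal lim)) tnth_mktuple.
Qed.

Lemma rec_fun_comp1 k F G :
  rec 1 F -> rec k G -> rec k (fun s => F [:: G s]).
Proof. by move=> rF rG; apply: (rec_fun_comp (G := fun=> G) rF). Qed.

Lemma rec_fun_comp2 k F G1 G2 :
  rec 2 F -> rec k G1 -> rec k G2 -> rec k (fun s => F [:: G1 s; G2 s]).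
Proof.
move=> rF r1 r2.
by apply: (rec_fun_comp (G := fun i => if i is 0 then G1 else G2) rF); case.
Qed.

Lemma rec_funS k F : rec k F -> rec k (fun s => (F s).+1).
Proof.
move=> rF; have rS : rec 1 (fun s => (nth 0 s 0).+1).
  have := rec_succ B; congr recursive_in; apply/funext => t.
  by congr S; exact: tnth_nth.
exact: (rec_fun_comp1 rS rF).
Qed.

Lemma rec_fun_const k c : rec k (fun=> c).
Proof.
elim: c => [|c IHc]; last exact: rec_funS.
exact: (@rec_fun_comp 0 k (fun=> 0) (fun _ _ => 0) (rec_zero B)).
Qed.

Lemma rec_fun1 (f : nat -> nat) :
  rec 1 (fun s => f (nth 0 s 0)) <->
  recursive_in B (fun t : 1.-tuple nat => f (thead t)).
Proof.
rewrite /rec_fun; suff -> : (fun t : 1.-tuple nat => f (thead t)) =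
  (fun t : 1.-tuple nat => f (nth 0 t 0)) by [].
by apply/funext => t; congr f; exact: tnth_nth.
Qed.

Lemma rec_fun_app1 f k F :
  rec 1 (fun s => f (nth 0 s 0)) -> rec k F -> rec k (fun s => f (F s)).
Proof. by move=> rf rF; exact: (rec_fun_comp1 rf rF). Qed.

Lemma rec_fun_app2 f k F G : rec 2 (fun s => f (nth 0 s 0) (nth 0 s 1)) ->
  rec k F -> rec k G -> rec k (fun s => f (F s) (G s)).
Proof. by move=> rf rF rG; exact: (rec_fun_comp2 rf rF rG). Qed.

Lemma rec_fun_oracle k F : rec k F -> rec k (fun s => F s \in B : nat).
Proof.
apply: (rec_fun_app1 (f := fun n => n \in B : nat)).
exact: (rec_fun1 (fun n => n \in B : nat)).2 (rec_oracle B).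
Qed.

Lemma rec_fun_prim k F G : rec k F -> rec k.+2 G ->
  rec k.+1 (fun s => nat_rect (fun=> nat) (F (behead s))
                       (fun n r => G [:: n, r & behead s]) (head 0 s)).
Proof. by move=> rF rG; apply: (rec_prim rF rG). Qed.

Lemma rec_fun_weak k F : rec k F -> rec k.+1 (fun s => F (behead s)).
Proof.
move=> rF.
have := @rec_fun_comp k k.+1 F (fun i s => nth 0 s i.+1) rF
  (fun i lik => @rec_fun_nth k.+1 i.+1 lik).
move=> /rec_fun_ext; apply; case=> [//|x s] /= [] <-; congr F.
by rewrite -[RHS](mkseq_nth 0).
Qed.

Lemma rec_fun_subst k F G :
  rec k.+1 F -> rec k G -> rec k (fun s => F (G s :: s)).
Proof.
move=> rF rG.
have := @rec_fun_comp k.+1 k F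
  (fun i => if i is j.+1 then nth 0 ^~ j else G) rF.
have r i : i < k.+1 -> rec k (if i is j.+1 then nth 0 ^~ j else G).
  by case: i => //= i lik; exact: rec_fun_nth.
move=> /(_ r) /rec_fun_ext; apply=> s <-; congr F.
apply: (@eq_from_nth _ 0); rewrite ?size_mkseq //= => -[|i] li.
  by rewrite nth_mkseq.
by rewrite nth_mkseq.
Qed.

(** In the step function, variable 0 is the counter, variable 1 the value so far, and the parameters
    start at variable 2. *)
Lemma rec_fun_iter k F G N : rec k F -> rec k.+2 G -> rec k N ->
  rec k (fun s => nat_rect (fun=> nat) (F s)
                    (fun n r => G [:: n, r & s]) (N s)).
Proof. by move=> rF rG rN; exact: (rec_fun_subst (rec_fun_prim rF rG) rN). Qed.

Lemma rec_funD k F G : rec k F -> rec k G -> rec k (fun s => F s + G s).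
Proof.
apply: (@rec_fun_app2 addn).
have := @rec_fun_iter 2 _ _ _ (@rec_fun_nth 2 1 isT)
  (rec_funS (@rec_fun_nth 4 1 isT))
  (@rec_fun_nth 2 0 isT).
move=> /rec_fun_ext; apply=> s _ /=.
by elim: (nth 0 s 0) => //= n ->; rewrite addSn.
Qed.

Lemma rec_funM k F G : rec k F -> rec k G -> rec k (fun s => F s * G s).
Proof.
apply: (@rec_fun_app2 muln).
have := @rec_fun_iter 2 _ _ _ (@rec_fun_const 2 0)
  (rec_funD (@rec_fun_nth 4 3 isT) (@rec_fun_nth 4 1 isT))
  (@rec_fun_nth 2 0 isT).
move=> /rec_fun_ext; apply=> s _ /=.
by elim: (nth 0 s 0) => //= n ->; rewrite mulSn.
Qed.

Lemma rec_fun_pred k F : rec k F -> rec k (fun s => (F s).-1).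
Proof.
apply: (@rec_fun_app1 predn).
have := @rec_fun_iter 1 _ _ _ (@rec_fun_const 1 0) (@rec_fun_nth 3 0 isT)
  (@rec_fun_nth 1 0 isT).
by move=> /rec_fun_ext; apply=> s _ /=; case: (nth 0 s 0).
Qed.

Lemma rec_funB k F G : rec k F -> rec k G -> rec k (fun s => F s - G s).
Proof.
apply: (@rec_fun_app2 subn).
have := @rec_fun_iter 2 _ _ _ (@rec_fun_nth 2 0 isT)
  (rec_fun_pred (@rec_fun_nth 4 1 isT)) (@rec_fun_nth 2 1 isT).
move=> /rec_fun_ext; apply=> s _ /=.
by elim: (nth 0 s 1) => [|n /= ->]; rewrite ?subn0 ?subnS.
Qed.

Lemma rec_fun_leq k F G : rec k F -> rec k G ->
  rec k (fun s => F s <= G s : nat).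
Proof.
move=> rF rG; have := rec_funB (rec_fun_const k 1) (rec_funB rF rG).
by move=> /rec_fun_ext; apply=> s _; lia.
Qed.

Lemma rec_fun_not k (P : seq nat -> bool) :
  rec k (fun s => P s : nat) -> rec k (fun s => ~~ P s : nat).
Proof.
move=> rP; have := rec_funB (rec_fun_const k 1) rP.
by move=> /rec_fun_ext; apply=> s _; case: (P s).
Qed.

Lemma rec_fun_and k (P Q : seq nat -> bool) :
  rec k (fun s => P s : nat) -> rec k (fun s => Q s : nat) ->
  rec k (fun s => P s && Q s : nat).
Proof.
move=> rP rQ; have := rec_funM rP rQ.
by move=> /rec_fun_ext; apply=> s _; case: (P s) (Q s) => [] [].
Qed.

Lemma rec_fun_sum k F N : rec k.+1 F -> rec k N ->
  rec k (fun s => \sum_(i < N s) F (val i :: s)).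
Proof.
move=> rF rN.
(* The summand has to skip variable 1, which holds the partial sum. *)
have rF' : rec k.+2 (fun s => F (nth 0 s 0 :: behead (behead s))).
  have r i : i < k.+1 -> rec k.+2 (nth 0 ^~ (if i is 0 then 0 else i.+1)).
    by case: i => [|i] lik; exact: rec_fun_nth.
  have := rec_fun_comp rF r; move=> /rec_fun_ext; apply.
  case=> [//|x [//|y s]] /= [] <-; congr F.
  apply: (@eq_from_nth _ 0); rewrite ?size_mkseq //= => -[|i] li.
    by rewrite nth_mkseq.
  by rewrite nth_mkseq.
have := rec_fun_iter (rec_fun_const k 0)
  (rec_funD (@rec_fun_nth k.+2 1 isT) rF') rN.
move=> /rec_fun_ext; apply=> s _ /=.
by elim: (N s) => [|n IHn] /=; rewrite ?big_ord0 // big_ord_recr /= IHn.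
Qed.

Lemma rec_fun_odd k F : rec k F -> rec k (fun s => odd (F s) : nat).
Proof.
apply: (@rec_fun_app1 odd).
have := @rec_fun_iter 1 _ _ _ (@rec_fun_const 1 0)
  (rec_funB (rec_fun_const _ 1) (@rec_fun_nth 3 1 isT))
  (@rec_fun_nth 1 0 isT).
move=> /rec_fun_ext; apply=> s _ /=.
by elim: (nth 0 s 0) => //= n ->; case: odd.
Qed.

Lemma rec_fun_half k F : rec k F -> rec k (fun s => (F s)./2).
Proof.
apply: (@rec_fun_app1 half).
have := @rec_fun_iter 1 _ _ _ (@rec_fun_const 1 0)
  (rec_funD (rec_fun_odd (@rec_fun_nth 3 0 isT)) (@rec_fun_nth 3 1 isT))
  (@rec_fun_nth 1 0 isT).
move=> /rec_fun_ext; apply=> s _ /=.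
by elim: (nth 0 s 0) => //= n ->; rewrite uphalf_half.
Qed.

(** Iterated halving; these quotients will give the length and the bits of a coded string. *)
Lemma rec_fun_div2X k F G :
  rec k F -> rec k G -> rec k (fun s => F s %/ 2 ^ G s).
Proof.
apply: (@rec_fun_app2 (fun x y => x %/ 2 ^ y)).
have := @rec_fun_iter 2 _ _ _ (@rec_fun_nth 2 0 isT)
  (rec_fun_half (@rec_fun_nth 4 1 isT)) (@rec_fun_nth 2 1 isT).
move=> /rec_fun_ext; apply=> s _ /=.
elim: (nth 0 s 1) => [|n /= ->]; first by rewrite divn1.
by rewrite -divn2 -divnMA expnSr.
Qed.

Lemma rec_fun_search (f : nat -> nat -> nat) (h : nat -> nat) :
  rec 2 (fun s => f (nth 0 s 0) (nth 0 s 1)) ->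
  (forall n, f (h n) n = 0) -> (forall n y, y < h n -> f y n <> 0) ->
  rec 1 (fun s => h (nth 0 s 0)).
Proof.
move=> rf h0 hmin; apply: (rec_min rf) => [t|t y] /=; first exact: h0.
exact: hmin.
Qed.

End RecFun.

(** * A large deviation bound on the Cantor space *)

(* [j <= n + j] makes [position] injective on pairs. *)
Definition position (n j : nat) : nat := (n + j) ^ 2 + j.

(** [position n j] is at least [(n + j) ^ 2] and less than [(n + j).+1 ^ 2], so it determines
    [n + j] and then [j]. *)
Lemma position_inj n j n' j' :
  position n j = position n' j' -> n = n' /\ j = j'.
Proof.
rewrite /position => e; have [l|l|e'] := ltngtP (n + j) (n' + j'); last by lia.
- have : (n + j).+1 ^ 2 <= (n' + j') ^ 2 by rewrite leq_exp2r.
  by rewrite !expnS; lia.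
- have : (n' + j').+1 ^ 2 <= (n + j) ^ 2 by rewrite leq_exp2r.
  by rewrite !expnS; lia.
Qed.

Lemma leq_position n j j' : j <= j' -> position n j <= position n j'.
Proof. by move=> le; rewrite leq_add // leq_exp2r // leq_add2l. Qed.

(** A prefix of this length contains every bit that the first [N] events read. *)
Definition position_bound (sigma : nat -> nat) (i N : nat) : nat :=
  \max_(m < N) (position (sigma m) i).+1.

Lemma ltn_position_bound sigma i N m j : m < N -> j <= i ->
  position (sigma m) j < position_bound sigma i N.
Proof.
move=> lm lj; apply: leq_ltn_trans (leq_position _ lj) _.
exact: (leq_bigmax (F := fun m : 'I_N => (position (sigma m) i).+1)
  (Ordinal lm)).
Qed.

(** Asks for the bit pattern 0...01 in columns 0 to [i]; with one condition per bit, the indicator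
    is a product over the bits. *)
Definition first_hit (i : nat) (x : nat -> bool) (n : nat) : bool :=
  [forall j : 'I_i.+1, x (position n j) == (j == i :> nat)].

Lemma first_hitP i (x : nat -> bool) n :
  reflect (x (position n i) /\ forall j, j < i -> x (position n j) = false)
          (first_hit i x n).
Proof.
apply: (iffP forallP) => [h|[h1 h2] j].
  split; first by have := h ord_max; rewrite eqxx => /eqP ->.
  move=> j lji; have := h (Ordinal (leqW lji)) => /=.
  by rewrite ltn_eqF // => /eqP.
have [->|ne] := eqVneq (val j) i; first by rewrite h1.
by rewrite h2 // ltn_neqAle ne -ltnS ltn_ord.
Qed.

Definition hits (sigma : nat -> nat) (i : nat) (x : nat -> bool) (N : nat) :=
  \sum_(m < N) first_hit i x (sigma m).

Lemma eq_hits sigma i (x y : nat -> bool) N :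
  (forall m j, m < N -> j <= i ->
     x (position (sigma m) j) = y (position (sigma m) j)) ->
  hits sigma i x N = hits sigma i y N.
Proof.
move=> exy; apply: eq_bigr => m _; congr nat_of_bool.
by apply: eq_forallb => j; rewrite exy // -ltnS.
Qed.

(** Bits are appended at the end, so that each step replaces a string by its two one-bit extensions,
    as averaging requires. *)
Fixpoint strings (L : nat) : seq (seq bool) :=
  if L is L'.+1 then
    flatten [seq [:: rcons s false; rcons s true] | s <- strings L']
  else [:: [::]].

Lemma size_strings L s : s \in strings L -> size s = L.
Proof.
elim: L s => [|L IHL] s /=; first by rewrite inE => /eqP ->.
move=> /flatten_mapP[s' /IHL <-]; rewrite !inE => /orP[]/eqP->;
by rewrite size_rcons.
Qed.

Lemma mkseq_in_strings (x : nat -> bool) L : mkseq x L \in strings L.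
Proof.
elim: L => [|L IHL] //=; apply/flatten_mapP; exists (mkseq x L) => //.
by rewrite mkseqS; case: (x L); rewrite !inE eqxx ?orbT.
Qed.

Local Open Scope ring_scope.

(* A product martingale: [cylinder_weight] is the conditional probability, given
   the bits listed in [s], of the event that [n] has its first hit at [i]. *)
Section Martingale.
Variables (R : realType) (sigma : nat -> nat) (i : nat) (theta : R).
Hypothesis sigma_inj : injective sigma.

Definition bit_weight (s : seq bool) (q : nat) (b : bool) : R :=
  if (q < size s)%N then (nth false s q == b)%:R else 2^-1.

Definition cylinder_weight (s : seq bool) (n : nat) : R :=
  \prod_(j < i.+1) bit_weight s (position n j) (j == i :> nat).

(** Conditional expectation, given [s], of [1 - theta] raised to the number of hits: by injectivity
    no bit is read by two of the events, so the expectation of the product is the product of the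
    expectations. *)
Definition martingale (N : nat) (s : seq bool) : R :=
  \prod_(m < N) (1 - theta * cylinder_weight s (sigma m)).

Lemma bit_weight_rcons s b q c : q != size s ->
  bit_weight (rcons s b) q c = bit_weight s q c.
Proof.
move=> ne; rewrite /bit_weight size_rcons ltnS leq_eqVlt (negbTE ne) /=.
by case: ltnP => // l; rewrite nth_rcons l.
Qed.

Lemma bit_weight_last s b c :
  bit_weight (rcons s b) (size s) c = (b == c)%:R.
Proof. by rewrite /bit_weight size_rcons leqnn nth_rcons ltnn eqxx. Qed.

Lemma cylinder_weight_rcons s b n :
  (forall j, (j <= i)%N -> position n j != size s) ->
  cylinder_weight (rcons s b) n = cylinder_weight s n.
Proof.
by move=> ne; apply: eq_bigr => j _; rewrite bit_weight_rcons // ne // -ltnS.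
Qed.

(** By [position_inj] at most one factor reads the new bit. Its values on the two extensions are 0
    and 1, against [2^-1] before the bit is known. *)
Lemma cylinder_weight_average s n :
  cylinder_weight (rcons s false) n + cylinder_weight (rcons s true) n =
  2 * cylinder_weight s n.
Proof.
have [[j ej]|nej] := pselect (exists j : 'I_i.+1, position n j = size s);
  last first.
  rewrite !cylinder_weight_rcons ?mulr2n ?mulrDl ?mul1r // => j lji;
  by apply/eqP => e; apply: nej; exists (inord j); rewrite inordK.
rewrite /cylinder_weight (bigD1 j) //= [X in _ + X](bigD1 j) //=.
rewrite [X in _ = _ * X](bigD1 j) //=.
have e b : \prod_(k < i.+1 | k != j)
    bit_weight (rcons s b) (position n k) (k == i :> nat) =
    \prod_(k < i.+1 | k != j) bit_weight s (position n k) (k == i :> nat).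
  apply: eq_bigr => k nkj; apply: bit_weight_rcons; rewrite -ej.
  by apply: contra nkj => /eqP /position_inj[_ /val_inj ->].
rewrite !e ej !bit_weight_last /bit_weight ltnn mulrA mulfV // -mulrDl.
by case: (_ == i); rewrite /= ?addr0 ?add0r.
Qed.

(** Distinct events share no bit, so the new bit changes at most one factor, and the product is
    affine in the weight occurring there. *)
Lemma martingale_average N s :
  martingale N (rcons s false) + martingale N (rcons s true) =
  2 * martingale N s.
Proof.
have [[m [j ej]]|nej] := pselect (exists (m : 'I_N) (j : 'I_i.+1),
    position (sigma m) j = size s); last first.
  have e b : martingale N (rcons s b) = martingale N s.
    apply: eq_bigr => m _; rewrite cylinder_weight_rcons // => j lji.
    by apply/eqP => e; apply: nej; exists m, (inord j); rewrite inordK.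
  by rewrite !e mulr2n mulrDl mul1r.
rewrite /martingale (bigD1 m) //= [X in _ + X](bigD1 m) //=.
rewrite [X in _ = _ * X](bigD1 m) //=.
have e b : \prod_(k < N | k != m)
    (1 - theta * cylinder_weight (rcons s b) (sigma k)) =
    \prod_(k < N | k != m) (1 - theta * cylinder_weight s (sigma k)).
  apply: eq_bigr => k nkm; rewrite cylinder_weight_rcons // => j' _.
  apply: contra nkm; rewrite -ej => /eqP /position_inj[/sigma_inj /val_inj ->].
  by [].
rewrite !e mulrA -mulrDl; congr (_ * _).
rewrite addrACA -opprD -mulrDr cylinder_weight_average mulrBr mulr1.
by rewrite [theta * (2 * _)]mulrCA.
Qed.

Lemma martingale_nil N : martingale N [::] = (1 - theta * 2^-1 ^+ i.+1) ^+ N.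
Proof.
rewrite /martingale /cylinder_weight /bit_weight /=.
by rewrite !prodr_const !card_ord.
Qed.

Lemma sum_martingale N L :
  \sum_(s <- strings L) martingale N s = 2 ^+ L * martingale N [::].
Proof.
elim: L => [|L IHL] /=; first by rewrite big_seq1 mul1r.
rewrite big_flatten big_map exprS -mulrA -IHL mulr_sumr.
by apply: eq_bigr => s _; rewrite !big_cons big_nil /= addr0 martingale_average.
Qed.

Lemma first_hit_natr x n :
  (first_hit i x n)%:R =
  \prod_(j < i.+1) (x (position n j) == (j == i :> nat))%:R :> R.
Proof.
rewrite /first_hit; case: forallP => [h|/existsNP[j /negP/negbTE nj]].
  by rewrite big1 // => j _; rewrite h.
by rewrite (bigD1 j) //= nj mul0r.
Qed.

(** Once every relevant bit is known, each weight is 0 or 1 and each factor is 1 or [1 - theta]. *)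
Lemma martingale_long N s :
  (forall m, (m < N)%N -> (position (sigma m) i < size s)%N) ->
  martingale N s = (1 - theta) ^+ hits sigma i (nth false s) N.
Proof.
move=> long; rewrite /hits -prodrXr; apply: eq_bigr => m _.
have -> : cylinder_weight s (sigma m) =
    (first_hit i (nth false s) (sigma m))%:R.
  rewrite first_hit_natr; apply: eq_bigr => j _; rewrite /bit_weight.
  rewrite (leq_ltn_trans _ (long m _)) //; apply: leq_position.
  by rewrite -ltnS.
by case: first_hit; rewrite ?mulr1 ?mulr0 ?subr0 ?expr1 ?expr0.
Qed.

End Martingale.

Lemma martingale_ge0 (R : realType) sigma i (theta : R) N s :
  0 <= theta <= 1 -> 0 <= martingale sigma i theta N s.
Proof.
move=> /andP[t0 t1]; apply: prodr_ge0 => m _; rewrite subr_ge0.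
apply: mulr_ile1 => //.
- apply: prodr_ge0 => j _; rewrite /bit_weight.
  by case: ifP => // _; case: (_ == _).
- apply: prodr_ile1 => j _; rewrite /bit_weight.
  by case: ifP => // _; [case: (_ == _); rewrite ?ler01 ?lexx|lra].
Qed.

(* Chernoff's bound, through the expectation of [(1 + t) ^- hits]. *)
Lemma count_few_hits (R : realType) (sigma : nat -> nat) (i N L : nat)
    (d : R) :
  injective sigma -> 0 < d -> d <= 1 ->
  (forall m, (m < N)%N -> (position (sigma m) i < L)%N) ->
  (count (fun s => (hits sigma i (nth false s) N)%:R <=
                     (2^-1 ^+ i.+1 - d) * N%:R) (strings L))%:R <=
  2 ^+ L * expR (- (d ^+ 2 / 4)) ^+ N.
Proof.
move=> sigma_inj d0 d1 long; pose p : R := 2^-1 ^+ i.+1.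
(* [theta] makes [1 - theta] equal to [(1 + t)^-1]. The final exponent per event is at most
   [- t * d + t ^ 2], which at [t = d / 2] is [- d ^ 2 / 4]. *)
pose t := d / 2; pose theta := t / (1 + t).
have t0 : 0 < t by rewrite /t; lra.
have t1 : 0 < 1 + t by lra.
have th : 1 - theta = (1 + t)^-1.
  by rewrite /theta -{1}(mulfV (lt0r_neq0 t1)) -mulrBl addrK mul1r.
have th01 : 0 <= theta <= 1.
  apply/andP; split; first by apply: divr_ge0; exact: ltW.
  by rewrite ler_pdivrMr // mul1r lerDr.
have p01 : 0 <= p <= 1.
  by rewrite exprn_ge0 //= exprn_ile1 // invf_le1 // ler1n.
have thb : t - t ^+ 2 <= theta.
  by rewrite /theta ler_pdivlMr //; nra.
set bad := (X in count X _).
have -> : (count bad (strings L))%:R = \sum_(s <- strings L | bad s) (1 : R).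
  by rewrite big_const_seq iter_addr_0.
(* Markov's inequality: on a bad string, [1 + t] to the number of hits is at most
   [expR (t * (p - d) * N%:R)], so the scaled martingale dominates the indicator of [bad]. *)
have wle s : s \in strings L -> bad s ->
    1 <= expR (t * (p - d) * N%:R) * martingale sigma i theta N s.
  move=> /size_strings szs; rewrite /bad -/p => few.
  rewrite martingale_long ?szs // th exprVn.
  rewrite ler_pdivlMr ?exprn_gt0 // mul1r.
  apply: (@le_trans _ _ (expR t ^+ hits sigma i (nth false s) N)).
    by rewrite lerXn2r ?nnegrE ?expR_ge0 ?expR_ge1Dx // ltW.
  by rewrite -expRM_natr ler_expR -mulrA ler_pM2l.
apply: (@le_trans _ _ (\sum_(s <- strings L)
    expR (t * (p - d) * N%:R) * martingale sigma i theta N s)).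
  rewrite big_mkcond big_seq [leRHS]big_seq; apply: ler_sum => s sL.
  case: ifP => [/wle->//|_].
  by rewrite mulr_ge0 ?expR_ge0 ?martingale_ge0.
rewrite -mulr_sumr sum_martingale // mulrCA ler_pM2l ?exprn_gt0 //.
rewrite martingale_nil -/p expRM_natr -exprMn lerXn2r ?nnegrE ?expR_ge0 //.
  apply: mulr_ge0; rewrite ?expR_ge0 // subr_ge0.
  by move: th01 p01 => /andP[? ?] /andP[? ?]; exact: mulr_ile1.
apply: (@le_trans _ _ (expR (t * (p - d)) * expR (- (theta * p)))).
  by rewrite ler_pM2l ?expR_gt0 // expR_ge1Dx.
rewrite -expRD ler_expR.
have tp : (t - t ^+ 2) * p <= theta * p by rewrite ler_wpM2r //; case/andP: p01.
have tp2 : t ^+ 2 * p <= t ^+ 2 by rewrite ler_piMr ?sqr_ge0 //; case/andP: p01.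
have -> : d = 2 * t by rewrite /t mulrCA mulfV // mulr1.
by move: tp tp2; nra.
Qed.

(** * Outer estimates for the fair-coin measure *)

(** Doubling a number with floor [k] gives floor [2 * k] or [2 * k + 1], and [bits] reads off the
    parity. *)
Lemma floor_bits (R : realType) (x : R) n : 0 <= x ->
  Num.floor (x * 2 ^+ n.+1) =
  Num.floor (x * 2 ^+ n) * 2 + Posz (n \in bits x).
Proof.
move=> x0; have y0 : 0 <= x * 2 ^+ n by rewrite mulr_ge0 // exprn_ge0.
have [k ek] : exists k : nat, Num.floor (x * 2 ^+ n) = k.
  by exists `|Num.floor (x * 2 ^+ n)|%N; rewrite gez0_abs // floor_ge0.
have [l el] : exists l : nat, Num.floor (x * 2 ^+ n.+1) = l.
  exists `|Num.floor (x * 2 ^+ n.+1)|%N.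
  by rewrite gez0_abs // floor_ge0 mulr_ge0 // exprn_ge0.
have -> : (n \in bits x) = odd l.
  by apply/idP/idP; rewrite /bits inE /= el.
have /andP[k1 k2] := real_floor_itv (num_real (x * 2 ^+ n)).
have /andP[l1 l2] := real_floor_itv (num_real (x * 2 ^+ n.+1)).
rewrite ek in k1 k2 *; rewrite el in l1 l2 *.
rewrite exprS mulrCA in l1 l2.
have b1 : (l%:Z < k%:Z * 2 + 2)%R.
  rewrite -(ltr_int R) (le_lt_trans l1) // intrD intrM.
  by move: k2; rewrite intrD; lra.
have b2 : (k%:Z * 2 < l%:Z + 1)%R.
  rewrite -(ltr_int R) (le_lt_trans _ l2) // intrM.
  by move: k1; lra.
by lia.
Qed.

Section FairCoin.
Variable R : realType.
Local Notation mu := (@lebesgue_measure R).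

(** [lebesgue_measure] unfolds to an outer measure, which is monotone and countably subadditive on
    arbitrary sets of reals. *)
Lemma le_lebesgue_outer (A B : set R) : A `<=` B -> (mu A <= mu B)%E.
Proof.
move=> AB.
rewrite /lebesgue_measure /lebesgue_stieltjes_measure /measure_extension.
exact: le_mu_ext.
Qed.

Lemma lebesgue_outer_sigma_subadditive (F : (set R)^nat) :
  (mu (\bigcup_n F n) <= \sum_(0 <= n <oo) mu (F n))%E.
Proof.
rewrite /lebesgue_measure /lebesgue_stieltjes_measure /measure_extension.
exact: outer_measure_sigma_subadditive.
Qed.

Lemma le_fair_coin U V : U `<=` V -> (fair_coin R U <= fair_coin R V)%E.
Proof. by move=> UV; apply: le_lebesgue_outer => x [x01 /UV]. Qed.

Lemma fair_coin_ge0 U : (0 <= fair_coin R U)%E.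
Proof. exact: measure_ge0. Qed.

Lemma fair_coin_bigcup (U : nat -> set (set nat)) :
  (fair_coin R (\bigcup_n U n) <= \sum_(0 <= n <oo) fair_coin R (U n))%E.
Proof.
rewrite /fair_coin preimage_bigcup setI_bigcupr.
exact: lebesgue_outer_sigma_subadditive.
Qed.

Lemma fair_coinU U V :
  (fair_coin R (U `|` V) <= fair_coin R U + fair_coin R V)%E.
Proof.
rewrite /fair_coin preimage_setU setIUr.
rewrite /lebesgue_measure /lebesgue_stieltjes_measure /measure_extension.
exact: outer_measureU2.
Qed.

(** The [foldl] is Horner's rule: [s] read as a binary numeral, most significant bit first. *)
Lemma floor_cylinder (x : R) s : 0 <= x < 1 -> cylinder s (bits x) ->
  Num.floor (x * 2 ^+ size s) = (foldl (fun v (b : bool) => v.*2 + b)%N 0%N s).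
Proof.
move=> /andP[x0 x1]; elim/last_ind: s => [_|s b IHs cs].
  by rewrite mulr1; apply/eqP; rewrite floor_eq x0 add0r.
rewrite size_rcons floor_bits // IHs.
  by rewrite cs ?size_rcons // nth_rcons ltnn eqxx -cats1 foldl_cat /=; lia.
move=> i li; rewrite cs ?size_rcons; last exact: leqW.
by rewrite nth_rcons li.
Qed.

(** The reals of [[0, 1[] whose bits extend [s] lie in a dyadic interval of length [2 ^- size s]. *)
Lemma fair_coin_cylinder s : (fair_coin R (cylinder s) <= (2 ^- size s)%:E)%E.
Proof.
pose v : R := (foldl (fun v (b : bool) => v.*2 + b)%N 0%N s)%:R.
have p0 : 0 < 2 ^+ size s :> R by rewrite exprn_gt0.
apply: (@le_trans _ _ (mu `[v / 2 ^+ size s, (v + 1) / 2 ^+ size s[)).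
  apply: le_lebesgue_outer => x [/= + cs]; rewrite in_itv /= => x01.
  have := real_floor_itv (num_real (x * 2 ^+ size s)).
  rewrite floor_cylinder // in_itv /= ler_pdivrMr // ltr_pdivlMr //.
  by rewrite intrD.
rewrite lebesgue_measure_itv /= lte_fin ltr_pM2r ?invr_gt0 // ltrDl ltr01.
by rewrite EFinN -EFinB lee_fin -mulrBl addrAC subrr add0r mul1r.
Qed.

Lemma fair_coin_seq (l : seq (seq bool)) L :
  (forall s, s \in l -> size s = L) ->
  (fair_coin R (open_class [set` l]) <= ((size l)%:R * 2 ^- L)%:E)%E.
Proof.
elim: l => [|s l IHl] sz.
  rewrite mul0r /fair_coin [X in mu X](_ : _ = set0) ?measure0 //.
  by rewrite -subset0 => x [_ [s]].
apply: (@le_trans _ _ (fair_coin R (cylinder s `|` open_class [set` l]))).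
  apply: le_fair_coin => Y [s' /=]; rewrite inE => /orP[/eqP -> ?|? ?].
    by left.
  by right; exists s'.
rewrite /= -natr1 addrC mulrDl mul1r EFinD (le_trans (fair_coinU _ _)) //.
apply: leeD; last by apply: IHl => s' s'l; rewrite sz // inE s'l orbT.
by rewrite -(sz s) ?fair_coin_cylinder // inE eqxx.
Qed.

(** The threshold frequency [a / b] is rational and cleared of its denominator, so that a finite
    prefix decides the event by integer arithmetic. *)
Definition few_hits (sigma : nat -> nat) (i a b N : nat) : set (set nat) :=
  [set Y | (b * hits sigma i (fun k => k \in Y) N < a * N)%N].

Lemma fair_coin_few_hits (sigma : nat -> nat) (i a b : nat) :
  injective sigma -> (a * 2 ^ i.+1 < b)%N ->
  exists2 c : R, 0 < c < 1 &
    forall N, (fair_coin R (few_hits sigma i a b N) <= (c ^+ N)%:E)%E.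
Proof.
move=> sigma_inj ab; pose d : R := 2^-1 ^+ i.+1 - a%:R / b%:R.
have b0 : 0 < b%:R :> R by rewrite ltr0n; lia.
have p0 : 0 < 2 ^+ i.+1 :> R by rewrite exprn_gt0.
have d0 : 0 < d.
  rewrite subr_gt0 exprVn ltr_pdivrMr // mulrC ltr_pdivlMr //.
  by rewrite -natrX -natrM ltr_nat.
have d1 : d <= 1.
  rewrite /d lerBlDr (@le_trans _ _ 1) //.
    by rewrite exprn_ile1 // invf_le1 // ler1n.
  by rewrite lerDl divr_ge0.
exists (expR (- (d ^+ 2 / 4))).
  rewrite expR_gt0 /= expR_lt1 oppr_lt0 divr_gt0 //.
  by rewrite exprn_gt0.
(* The event depends on the first [L] bits only, so it is covered by the cylinders of the bad
   strings of length [L]. *)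
move=> N; pose L := position_bound sigma i N.
have long m : (m < N)%N -> (position (sigma m) i < L)%N.
  by move=> lm; exact: ltn_position_bound.
have := count_few_hits sigma_inj d0 d1 long; set bad := (X in count X _).
rewrite -size_filter => cnt.
apply: (@le_trans _ _
  (fair_coin R (open_class [set` [seq s <- strings L | bad s]]))).
  apply: le_fair_coin => Y YN; exists (mkseq (fun k => k \in Y) L).
    rewrite /= mem_filter mkseq_in_strings andbT /bad.
    rewrite (@eq_hits _ _ _ (fun k => k \in Y)); last first.
      by move=> m j lm lj; rewrite nth_mkseq // ltn_position_bound.
    rewrite /d subKr mulrAC ler_pdivlMr // -!natrM ler_nat mulnC ltnW //.
  by move=> k; rewrite size_mkseq => lk; rewrite nth_mkseq.
apply: le_trans (fair_coin_seq (L := L) _) _.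
  by move=> s; rewrite mem_filter => /andP[_ /size_strings].
by rewrite lee_fin ler_pdivrMr ?exprn_gt0 // mulrC.
Qed.

Lemma fair_coin_geometric (U : nat -> set (set nat)) (c : R) : 0 < c < 1 ->
  (forall N, (fair_coin R (U N) <= (c ^+ N)%:E)%E) ->
  exists C, forall n,
    (fair_coin R (\bigcup_k U (C * n.+1 + k)%N) <= (2 ^- n)%:E)%E.
Proof.
move=> /andP[c0 c1] Uc; have c1' : 0 < 1 - c by rewrite subr_gt0.
(* The bounds from [M] on sum to [c ^+ M / (1 - c)]: the factor [1 - c] absorbs the denominator and
   the 1/2 yields [2 ^- n]. A single [C] for all [n] keeps the start [C * n.+1] computable. *)
have [C hC] : exists C, c ^+ C <= (1 - c) / 2.
  have cn : `|c| < 1 by rewrite ger0_norm // ltW.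
  have /cvgrPdist_le/(_ ((1 - c) / 2)) := cvg_expr cn.
  case; first by rewrite divr_gt0.
  move=> C _ /(_ C (leqnn C)) /=; rewrite sub0r normrN ger0_norm.
    by exists C.
  by rewrite exprn_ge0 // ltW.
exists C => n; set M := (C * n.+1)%N.
apply: le_trans (fair_coin_bigcup _) _.
have cM : c ^+ M / (1 - c) <= 2 ^- n.
  rewrite ler_pdivrMr // /M exprM.
  apply: (@le_trans _ _ (((1 - c) / 2) ^+ n.+1)).
    by rewrite lerXn2r ?nnegrE ?exprn_ge0 ?divr_ge0 // ltW.
  rewrite exprMn exprVn mulrC exprS invfM exprS.
  have h1 : (1 - c) ^+ n <= 1 by apply: exprn_ile1; lra.
  have h2 : 0 < (2 ^+ n)^-1 :> R by rewrite invr_gt0 exprn_gt0.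
  rewrite [2^-1 * _]mulrC -mulrA ler_pM2l //.
  have : 0 <= (1 - c) ^+ n by rewrite exprn_ge0 // ltW.
  by nra.
have lim k : (\sum_(0 <= j < k) fair_coin R (U (M + j)%N) <= (2 ^- n)%:E)%E.
  apply: (@le_trans _ _ (\sum_(0 <= j < k) (c ^+ M * c ^+ j)%:E)%E).
    by apply: lee_sum => j _; rewrite -exprD.
  rewrite sumEFin lee_fin (le_trans _ cM) //.
  have := @geometric_le_lim R k (c ^+ M) c; rewrite /series /=; apply => //.
    by rewrite exprn_ge0 // ltW.
  by rewrite ger0_norm // ltW.
apply: lime_le; last by near=> k; exact: lim.
by apply: is_cvg_nneseries => k _ _; exact: fair_coin_ge0.
Unshelve. all: by end_near. Qed.

End FairCoin.

Local Open Scope nat_scope.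

(** * A test against rare large deviations *)

Section RecFirstHit.
Variable B : set nat.
Local Notation rec := (rec_fun B).

Lemma rec_fun_position k F G :
  rec k F -> rec k G -> rec k (fun s => position (F s) (G s)).
Proof.
move=> rF rG; have rFG := rec_funD rF rG.
exact: rec_funD (rec_funM rFG rFG) rG.
Qed.

Lemma first_hitE i x n :
  first_hit i x n = x (position n i) && (\sum_(j < i) x (position n j) <= 0).
Proof.
apply/first_hitP/andP => -[xi xj]; split=> //.
  by rewrite leqn0 sum_nat_eq0; apply/forallP => j; rewrite xj.
move: xj; rewrite leqn0 sum_nat_eq0 => /forallP xj j lji.
by have /= := xj (Ordinal lji); case: (x _).
Qed.

(** [E] indexes the bit sequence: the code of a string for the test, a dummy constant when the bits
    come from the oracle. *)
Lemma rec_fun_first_hit (y : nat -> nat -> bool) k E I F :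
  rec 2 (fun s => y (nth 0 s 0) (nth 0 s 1) : nat) ->
  rec k E -> rec k I -> rec k F ->
  rec k (fun s => first_hit (I s) (y (E s)) (F s) : nat).
Proof.
move=> ry rE rI rF.
have ry' k' G H : rec k' G -> rec k' H -> rec k' (fun s => y (G s) (H s) : nat).
  exact: (rec_fun_app2 (f := fun u v => y u v : nat)).
have r1 := ry' _ _ _ rE (rec_fun_position rF rI).
have r2 := ry' _ _ _ (rec_fun_weak rE)
  (rec_fun_position (rec_fun_weak rF) (@rec_fun_nth B k.+1 0 isT)).
have r3 := rec_fun_leq (rec_fun_sum r2 rI) (rec_fun_const B k 0).
have := rec_fun_and r1 r3; move=> /rec_fun_ext; apply => s _.
by rewrite first_hitE.
Qed.

End RecFirstHit.

Lemma computable_inverse (f g : nat -> nat) :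
  computable f -> cancel f g -> cancel g f -> computable g.
Proof.
move=> cf fK gK; apply/rec_fun1.
have rf : rec_fun set0 1 (fun s => f (nth 0 s 0)) by exact/rec_fun1.
(* With truncated subtraction this is the distance from [f y] to [n], so the search for a zero finds
   the preimage of [n]. *)
pose d y n := (f y - n) + (n - f y).
apply: (@rec_fun_search _ d).
- have r0 := @rec_fun_nth set0 2 0 isT; have r1 := @rec_fun_nth set0 2 1 isT.
  have rf0 := rec_fun_app1 rf r0.
  exact: rec_funD (rec_funB rf0 r1) (rec_funB r1 rf0).
- by move=> n; rewrite /d gK subnn.
- move=> n y lt e; have fy : f y = n by move: e; rewrite /d; lia.
  by move: lt; rewrite -fy fK ltnn.
Qed.

(** The successor of the code is the number with binary digits [s], least significant first,
    followed by a leading 1. Its quotients by powers of two therefore yield the length and the bits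
    of [s]. *)
Lemma string_code_cons b s :
  (string_code (b :: s)).+1 = (string_code s).+1.*2 + b.
Proof. by rewrite /=; lia. Qed.

Lemma string_code_surj c : exists s, string_code s = c.
Proof.
elim/ltn_ind: c => -[|c] IHc; first by exists [::].
have [|s es] := IHc c./2; first by lia.
by exists (odd c :: s); rewrite /= es; lia.
Qed.

Lemma ltn_size_string s k :
  (k < size s) = (0 < (string_code s).+1 %/ 2 ^ k.+1).
Proof.
elim: s k => [|b s IHs] [|k]; rewrite ?string_code_cons.
- by [].
- by rewrite divn_small // (@ltn_exp2l 2 0).
- by rewrite /= expn1 divn_gt0 //; lia.
rewrite expnS divnMA [X in X %/ _](_ : _ = (string_code s).+1) //.
  exact: IHs.
by rewrite divn2; lia.
Qed.

Lemma nth_string s k :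
  k < size s -> nth false s k = odd ((string_code s).+1 %/ 2 ^ k).
Proof.
elim: s k => [//|b s IHs] [|k] lk; rewrite string_code_cons.
  by rewrite divn1 oddD odd_double; case: (b).
rewrite expnS divnMA [X in X %/ _](_ : _ = (string_code s).+1) //.
  exact: IHs.
by rewrite divn2; lia.
Qed.

(** The length condition makes [s] decide the first [N] events: the default of [nth] is never read,
    and the whole cylinder has few hits. *)
Definition few_hits_test (sigma : nat -> nat) (i a b C n : nat) :
    set (seq bool) :=
  [set s | exists N, [/\ C * n.+1 <= N,
    forall m, m < N -> position (sigma m) i < size s &
    b * hits sigma i (nth false s) N < a * N]].

Lemma open_few_hits_test sigma i a b C n :
  open_class (few_hits_test sigma i a b C n) =
  \bigcup_k few_hits sigma i a b (C * n.+1 + k).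
Proof.
apply/seteqP; split => Y.
  move=> [s [N [lN long few]] cs]; exists (N - C * n.+1) => //.
  rewrite subnKC // /few_hits /= (@eq_hits _ _ _ (nth false s)) //.
  move=> m j lm lj; apply: cs.
  exact: leq_ltn_trans (leq_position _ lj) (long _ lm).
move=> [k _]; set N := _ + k => few.
pose L := position_bound sigma i N.
exists (mkseq (fun k => k \in Y) L); last first.
  by move=> j; rewrite size_mkseq => lj; rewrite nth_mkseq.
exists N; split; first exact: leq_addr.
  by move=> m lm; rewrite size_mkseq ltn_position_bound.
rewrite (@eq_hits _ _ _ (fun k => k \in Y)) // => m j lm lj.
by rewrite nth_mkseq // ltn_position_bound.
Qed.

Lemma ce_few_hits_test sigma i a b C : computable sigma ->
  ce [set t : 2.-tuple nat | exists n s,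
    few_hits_test sigma i a b C n s /\ t = [tuple n; string_code s]].
Proof.
move=> csigma; have rsigma := (rec_fun1 _ sigma).2 csigma.
pose bit c k := odd (c.+1 %/ 2 ^ k).
(* A decidable relation with [N] as the witness to search for; the first sum counts the [m < N]
   whose bits overrun the string and must vanish. *)
pose P N n c := [&& C * n.+1 <= N,
  \sum_(m < N) ~~ (1 <= c.+1 %/ 2 ^ (position (sigma m) i).+1) <= 0 &
  (b * \sum_(m < N) first_hit i (bit c) (sigma m)).+1 <= a * N].
have rP : rec_fun set0 3
    (fun s => ~~ P (nth 0 s 0) (nth 0 s 1) (nth 0 s 2) : nat).
  pose r3 := @rec_fun_nth set0 3; pose r4 := @rec_fun_nth set0 4.
  have rc k := rec_fun_const set0 k.
  have rs := rec_fun_app1 rsigma (r4 0 isT).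
  have rbit : rec_fun set0 2 (fun s => bit (nth 0 s 0) (nth 0 s 1) : nat).
    by apply/rec_fun_odd/rec_fun_div2X; [apply/rec_funS|]; exact: rec_fun_nth.
  apply/rec_fun_not/rec_fun_and; last apply/rec_fun_and.
  - apply: rec_fun_leq (r3 0 isT).
    exact: rec_funM (rc 3 C) (rec_funS (r3 1 isT)).
  - apply: rec_fun_leq (rc 3 0).
    apply: (rec_fun_sum (F := fun s => ~~ (1 <= (nth 0 s 3).+1 %/
      2 ^ (position (sigma (nth 0 s 0)) i).+1) : nat) _ (r3 0 isT)).
    apply/rec_fun_not/(rec_fun_leq (rc 4 1))/rec_fun_div2X.
      exact: rec_funS (r4 3 isT).
    exact: rec_funS (rec_fun_position rs (rc 4 i)).
  - apply: rec_fun_leq (rec_funM (rc 3 a) (r3 0 isT)).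
    apply/rec_funS/(rec_funM (rc 3 b)).
    apply: (rec_fun_sum (F := fun s => first_hit i (bit (nth 0 s 3))
      (sigma (nth 0 s 0)) : nat) _ (r3 0 isT)).
    exact: rec_fun_first_hit rbit (r4 3 isT) (rc 4 i) rs.
have PE N n s : P N n (string_code s) <-> [/\ C * n.+1 <= N,
    forall m, m < N -> position (sigma m) i < size s &
    b * hits sigma i (nth false s) N < a * N].
  have longE : \sum_(m < N) ~~ (1 <= (string_code s).+1 %/
      2 ^ (position (sigma m) i).+1) <= 0 <->
      forall m, m < N -> position (sigma m) i < size s.
    rewrite leqn0 sum_nat_eq0; split => [/forallP h m lm|h].
      have := h (Ordinal lm); rewrite /= ltn_size_string.
      by case: (0 < _).
    by apply/forallP => m; rewrite -ltn_size_string h.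
  have hitsE : (forall m, m < N -> position (sigma m) i < size s) ->
      hits sigma i (nth false s) N =
      \sum_(m < N) first_hit i (bit (string_code s)) (sigma m).
    move=> long; apply: eq_hits => m j lm lj; apply: nth_string.
    exact: leq_ltn_trans (leq_position _ lj) (long _ lm).
  split=> [/and3P[h1 /longE h2 h3]|[h1 h2 h3]].
    by split => //; rewrite hitsE.
  by apply/and3P; split => //; [apply/longE|rewrite -hitsE].
exists (fun t => ~~ P (nth 0 t 0) (nth 0 t 1) (nth 0 t 2)) => // t.
split=> [[n [s [[N hN] ->]]]|[N /= hN]].
  by exists N; rewrite /=; move/PE: hN => ->.
have [s es] := string_code_surj (nth 0 t 1).
exists (nth 0 t 0), s; split.
  by exists N; apply/PE; rewrite es; move: hN; case: (P _ _ _).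
by apply/val_inj; case: t es {hN} => -[|u [|v []]] //= _ ->.
Qed.

(** [X] escapes some level [n] of the test, and that level contains every set with too few hits at
    some [N] from [C * n.+1] on. *)
Lemma ML_random_hits (R : realType) (X : set nat) sigma i a b :
  ML_random R X -> computable sigma -> injective sigma ->
  a * 2 ^ i.+1 < b ->
  exists N0, forall N, N0 <= N ->
    a * N <= b * hits sigma i (fun k => k \in X) N.
Proof.
move=> rX csigma isigma ab.
have [c c01 Uc] := fair_coin_few_hits R isigma ab.
have [C hC] := fair_coin_geometric c01 Uc.
have test : ML_test R (few_hits_test sigma i a b C).
  split; first exact: ce_few_hits_test.
  by move=> n; rewrite open_few_hits_test.
have /existsNP[n] := rX _ test; move=> /not_implyP[_].
rewrite open_few_hits_test => notin.
exists (C * n.+1) => N lN; rewrite leqNgt; apply/negP => few.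
by apply: notin; exists (N - C * n.+1) => //; rewrite subnKC.
Qed.

(** * Assembling the density from the bits of [r] *)

Lemma first_hit_uniq x n i j : first_hit i x n -> first_hit j x n -> i = j.
Proof.
move=> /first_hitP[xi hi] /first_hitP[xj hj]; have [lij|lij|//] := ltngtP i j.
  by move: xi; rewrite hj.
by move: xj; rewrite hi.
Qed.

Lemma sum_first_hit x n k (P : pred nat) :
  \sum_(i < k | P i) first_hit i x n =
  [exists i : 'I_k, P i && first_hit i x n].
Proof.
case: existsP => [[i /andP[Pi hi]]|noti].
  rewrite (bigD1 i) //= hi big1 // => j /andP[_ ne]; apply/eqP.
  by rewrite eqb0; apply: contra ne => /first_hit_uniq/(_ hi)/val_inj ->.
rewrite big1 // => i Pi; apply/eqP; rewrite eqb0; apply/negP => hi.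
by apply: noti; exists i; rewrite Pi.
Qed.

(** The bound [i <= n] leaves finitely many columns to inspect, so the join decides membership; each
    column loses only finitely many [n]. *)
Definition selected (Y X : set nat) : set nat :=
  [set n | exists i, [/\ i <= n, i \in Y & first_hit i (fun k => k \in X) n]].

Lemma computes_selected Y X : computes (join Y X) (selected Y X).
Proof.
set B := join Y X.
have YE n : (n.*2 \in B) = (n \in Y).
  apply/idP/idP; rewrite !inE; last by left; exists n.
  by case=> [[m ? /double_inj <-//]|[m _ e]]; lia.
have XE n : (n.*2.+1 \in B) = (n \in X).
  apply/idP/idP; rewrite !inE; last by right; exists n.
  by case=> [[m _ e]|[m ? [/double_inj <-]]] //; lia.
have rdouble k F : rec_fun B k F -> rec_fun B k (fun s => (F s).*2).
  move=> rF; have := rec_funD rF rF.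
  by move=> /rec_fun_ext; apply => s _; rewrite addnn.
have rY : rec_fun B 2 (fun s => nth 0 s 0 \in Y : nat).
  have := rec_fun_oracle (rdouble _ _ (@rec_fun_nth B 2 0 isT)).
  by move=> /rec_fun_ext; apply => s _; rewrite YE.
have rX : rec_fun B 2 (fun s => nth 0 s 1 \in X : nat).
  have := rec_fun_oracle (rec_funS (rdouble _ _ (@rec_fun_nth B 2 1 isT))).
  by move=> /rec_fun_ext; apply => s _; rewrite XE.
have rhit := rec_fun_first_hit (y := fun _ k => k \in X) rX
  (rec_fun_const B 2 0) (@rec_fun_nth B 2 0 isT) (@rec_fun_nth B 2 1 isT).
apply: (rec_fun1 _ (fun n => n \in selected Y X : nat)).1.
have := rec_fun_leq (rec_fun_const B 1 1)
  (rec_fun_sum (rec_fun_and rY rhit) (rec_funS (@rec_fun_nth B 1 0 isT))).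
move=> /rec_fun_ext; apply => s _ /=; congr nat_of_bool; set n := nth 0 s 0.
rewrite lt0n sum_nat_eq0 negb_forall; apply/existsP/idP.
  move=> [i /=]; rewrite eqb0 negbK => /andP[iY hi].
  by rewrite inE; exists i; split => //; rewrite -ltnS.
rewrite inE => -[i [lin iY hi]]; exists (Ordinal (lin : i < n.+1)) => /=.
by rewrite iY hi.
Qed.

(** A first hit in a column of [Y] selects [n] unless the column exceeds [n], which forces
    [n < k]. *)
Lemma sum_selected_lower (Y X : set nat) n k :
  \sum_(i < k | (i : nat) \in Y) first_hit i (fun k => k \in X) n <=
  (n \in selected Y X) + (n < k).
Proof.
rewrite (sum_first_hit _ _ _ (fun i => i \in Y)).
case: existsP => [[i /andP[iY hi]]|//]; case: ltnP => [_|lkn].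
  by rewrite addn1.
suff -> : n \in selected Y X by [].
rewrite inE; exists (val i); split => //.
exact: ltnW (leq_trans (ltn_ord i) lkn).
Qed.

(** The first column containing [n] is unique, so it cannot lie both in [Y] and outside [Y]. *)
Lemma sum_selected_upper (Y X : set nat) n k :
  \sum_(i < k | (i : nat) \notin Y) first_hit i (fun k => k \in X) n +
  (n \in selected Y X) <= 1.
Proof.
rewrite (sum_first_hit _ _ _ (fun i => i \notin Y)).
case: existsP => [[i /andP[iY hi]]|_]; last by case: (n \in _).
case: (boolP (n \in selected Y X)) => // /[!inE] -[j [_ jY hj]].
by move: iY; rewrite (first_hit_uniq hi hj) jY.
Qed.

Lemma count_iota (p : pred nat) N :
  count p (iota 0 N) = \sum_(m < N) p m.
Proof.
rewrite -sum1_count big_mkcond -(big_mkord predT (fun m => p m : nat)).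
by rewrite /index_iota subn0; apply: eq_bigr => m _; case: (p m).
Qed.

(** Limits the exceptional elements below [k], in whatever order [sigma] lists them. *)
Lemma sum_inj_lt (sigma : nat -> nat) N k : injective sigma ->
  \sum_(m < N) (sigma m < k) <= k.
Proof.
move=> isigma; rewrite -(count_iota (fun m => sigma m < k)) -size_filter.
rewrite -(size_map sigma) -[leqRHS](size_iota 0); apply: uniq_leq_size.
  by rewrite map_inj_uniq // filter_uniq // iota_uniq.
move=> _ /mapP[m + ->]; rewrite mem_filter => /andP[lt _].
by rewrite mem_iota add0n.
Qed.

Local Open Scope ring_scope.

Section Density.
Variables (R : realType) (X : set nat) (sigma : nat -> nat).
Hypotheses (rX : ML_random R X) (csigma : computable sigma).
Hypothesis isigma : injective sigma.
Local Notation h i N := (hits sigma i (fun k => k \in X) N).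

Lemma hits_lower i (e : R) : 0 < e ->
  exists N0, forall N, (N0 <= N)%N -> (2 ^- i.+1 - e) * N%:R <= (h i N)%:R.
Proof.
(* The threshold [M.-1 / b] equals [2 ^- i.+1 * (1 - 1 / M)], and [1 / M < e]. *)
move=> e0; pose M := (Num.bound e^-1).
have M0 : e^-1 < M%:R by apply: archi_boundP; rewrite invr_ge0 ltW.
pose b := (2 ^ i.+1 * M)%N; have Mp : (0 < M)%N.
  by rewrite -(ltr_nat R) (lt_trans _ M0) // invr_gt0.
have ab : (M.-1 * 2 ^ i.+1 < b)%N.
  by rewrite /b [leqRHS]mulnC ltn_pmul2r ?expn_gt0 // prednK.
have [N0 hN0] := ML_random_hits rX csigma isigma ab.
exists N0 => N /hN0; rewrite -(ler_nat R) !natrM natrX => hN.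
have p0 : 0 < 2 ^+ i.+1 :> R by rewrite exprn_gt0.
have p1 : 1 <= 2 ^+ i.+1 :> R by rewrite exprn_ege1 // ler1n.
have Me : 1 <= M%:R * e by rewrite -ler_pdivrMr // mul1r ltW.
have MR : 0 < M%:R :> R by rewrite ltr0n.
rewrite -(ler_pM2l (mulr_gt0 p0 MR)); apply: le_trans hN.
rewrite mulrA ler_wpM2r // -subn1 natrB // mulrBr mulrAC mulfV ?gt_eqF // mul1r.
by rewrite lerB // -mulrA mulr_ege1.
Qed.

Lemma sum_hits_lower (P : pred nat) k (e : R) : 0 < e ->
  exists N0, forall N, (N0 <= N)%N ->
    (\sum_(i < k | P i) 2 ^- i.+1 - e) * N%:R <=
    (\sum_(i < k | P i) h i N)%:R.
Proof.
elim: k e => [|k IHk] e e0.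
  exists 0%N => N _; rewrite !big_ord0 sub0r mulNr oppr_le0.
  by rewrite mulr_ge0 // ltW.
have e2 : 0 < e / 2 by rewrite divr_gt0.
have [N1 h1] := IHk _ e2; have [N2 h2] := hits_lower k e2.
exists (maxn N1 N2) => N; rewrite geq_max => /andP[/h1 {}h1 /h2 {}h2].
rewrite big_mkcond [X in (_ <= X%:R)]big_mkcond !big_ord_recr /=.
rewrite -big_mkcond -[X in (_ <= (X + _)%:R)]big_mkcond natrD.
have N0 : 0 <= N%:R :> R by [].
by case: (P k); nra.
Qed.

End Density.

Lemma sum_bits_floor (R : realType) (r : R) k : 0 <= r < 1 ->
  \sum_(i < k | (i : nat) \in bits r) 2 ^- i.+1 =
  (Num.floor (r * 2 ^+ k))%:~R / 2 ^+ k :> R.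
Proof.
move=> /andP[r0 r1]; elim: k => [|k IHk].
  rewrite big_ord0 mulr1; suff -> : Num.floor r = 0 by rewrite mul0r.
  by apply/eqP; rewrite floor_eq r0 add0r.
rewrite big_mkcond big_ord_recr -big_mkcond IHk floor_bits // intrD intrM.
rewrite mulrDl [X in _ / X + _]exprS; congr (_ + _).
  by rewrite invfM mulrA -(mulrA _ 2) mulfV // mulr1.
by case: (_ \in _); rewrite ?mul1r ?mul0r.
Qed.

Lemma sum_bits_bounds (R : realType) (r : R) k : 0 <= r < 1 ->
  let q : R := \sum_(i < k | (i : nat) \in bits r) 2 ^- i.+1 in
  q <= r < q + 2 ^- k.
Proof.
move=> r01 /=; rewrite sum_bits_floor //.
have p0 : 0 < 2 ^+ k :> R by rewrite exprn_gt0.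
have := real_floor_itv (num_real (r * 2 ^+ k)); rewrite intrD => fl.
by rewrite ler_pdivrMr // -[X in _ + X]mul1r -mulrDl ltr_pdivlMr.
Qed.

Lemma sum_half_powers (R : realType) k :
  \sum_(i < k) 2 ^- i.+1 = 1 - 2 ^- k :> R.
Proof.
elim: k => [|k IHk]; first by rewrite big_ord0 invr1 subrr.
by rewrite big_ord_recr /= IHk exprS invfM; lra.
Qed.

Theorem theorem4p2 (R : realType) (r : R) (hr0 : 0 < r) (hr1 : r < 1)
    (X : set nat) (hX : ML_random R X) :
  exists A : set nat,
    computes (join (bits r) X) A /\ has_intrinsic_density A r.
Proof.
exists (selected (bits r) X); split; first exact: computes_selected.
move=> pi cpi [sigma piK sigmaK]; set A := selected _ _.
have csigma := computable_inverse cpi piK sigmaK.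
have isigma : injective sigma := can_inj sigmaK.
have countE N : count (fun i => i \in pi @` A) (iota 0 N) =
    (\sum_(m < N) (sigma m \in A))%N.
  rewrite count_iota; apply: eq_bigr => m _; congr nat_of_bool.
  apply/idP/idP; rewrite !inE; first by move=> [a Aa <-]; rewrite piK.
  by exists (sigma m).
apply/cvgrPdist_le => /= e e0; have e4 : 0 < e / 4 by rewrite divr_gt0.
(* The columns from [k] on have total mass [2 ^- k]; they are left out of both estimates. *)
have [k hk] : exists k, 2 ^- k <= e / 4 :> R.
  have h1 : `|2^-1 : R| < 1 by rewrite ger0_norm // invf_lt1 // ltr1n.
  have /cvgrPdist_le/(_ _ e4)[k _ /(_ k (leqnn k))] := cvg_expr h1.
  by rewrite /= sub0r normrN ger0_norm ?exprn_ge0 // exprVn; exists k.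
have [N1 h1] := sum_hits_lower hX csigma isigma (fun i => i \in bits r) k e4.
have [N2 h2] := sum_hits_lower hX csigma isigma (fun i => i \notin bits r) k e4.
pose q : R := \sum_(i < k | (i : nat) \in bits r) 2 ^- i.+1.
pose q' : R := \sum_(i < k | (i : nat) \notin bits r) 2 ^- i.+1.
have /andP[q1 q2] : q <= r < q + 2 ^- k.
  by apply: sum_bits_bounds; rewrite ltW.
have qq : q + q' = 1 - 2 ^- k.
  rewrite -sum_half_powers.
  by rewrite [RHS](bigID (fun i : 'I_k => (i : nat) \in bits r)).
(* From [N3] on, the [k] exceptional elements cost at most [e / 4] in frequency. *)
pose N3 := Num.bound (k%:R / (e / 4)).
exists (maxn 1 (maxn N1 (maxn N2 N3))) => // N /=.
rewrite !geq_max => /and4P[Np /h1 {}h1 /h2 {}h2 N3N].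
have kN : k%:R <= e / 4 * N%:R.
  rewrite mulrC -ler_pdivrMr //.
  apply: (@le_trans _ _ N3%:R); last by rewrite ler_nat.
  by apply/ltW/archi_boundP; rewrite divr_ge0 // ltW.
have NR : 0 < N%:R :> R by rewrite ltr0n.
have c1 : (\sum_(i < k | (i : nat) \in bits r)
      hits sigma i (fun j => j \in X) N <=
    \sum_(m < N) (sigma m \in A) + k)%N.
  rewrite exchange_big /=.
  apply: leq_trans (leq_add (leqnn _) (sum_inj_lt N k isigma)).
  by rewrite -big_split; apply: leq_sum => m _; exact: sum_selected_lower.
have c2 : (\sum_(i < k | (i : nat) \notin bits r)
      hits sigma i (fun j => j \in X) N +
    \sum_(m < N) (sigma m \in A) <= N)%N.
  rewrite exchange_big -big_split /=.
  apply: (@leq_trans (\sum_(m < N) 1)); last by rewrite sum1_card card_ord.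
  by apply: leq_sum => m _; exact: sum_selected_upper.
move: c1 c2; rewrite -!(ler_nat R) !natrD => c1 c2.
rewrite /rho_n countE; set a := (X in X / _).
rewrite /= -/q -/q' in h1 h2; rewrite -/a in c1 c2.
(* At most [e / 4] is lost to each of the hit estimate, the [k] exceptions and the tail [2 ^- k]. *)
have lower : r - e <= a / N%:R.
  have : (r - e) * N%:R <= (q - e / 2) * N%:R by rewrite ler_pM2r //; lra.
  by rewrite ler_pdivlMr //; lra.
(* Here [1 - q'] equals [q + 2 ^- k], which is at most [r + e / 4]. *)
have upper : a / N%:R <= r + e.
  have : (1 - q' + e / 4) * N%:R <= (r + e) * N%:R by rewrite ler_pM2r //; lra.
  by rewrite ler_pdivrMr //; lra.
by rewrite ler_norml; lra.
Qed.
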